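(* Let $\boldsymbol{u}\colon\mathbb{N}\to\mathbb{C}$ be an arithmetic function. The following are equivalent: (a) the Sarnak property relatively to $\boldsymbol{u}$ holds for all topological dynamical systems of zero topological entropy; (b) the strong MOMO property relatively to $\boldsymbol{u}$ holds for all topological dynamical systems of zero topological entropy. In particular, Sarnak's conjecture holds if and only if the strong MOMO property relatively to the Möbius function $\boldsymbol{\mu}$ holds for all topological dynamical systems of zero topological entropy.
   Context: A topological dynamical system $(X,T)$ is a compact metric space $X$ with a continuous map $T\colon X\to X$. Sums over $n$ start at $n=0$; put $\boldsymbol{u}(0):=0$ if $\boldsymbol{u}$ is only given on positive integers (immaterial). Sarnak property of $(X,T)$ relatively to $\boldsymbol{u}$: for every $x\in X$ and $f\in C(X)$, $\frac1N\sum_{n<N}f(T^nx)\boldsymbol{u}(n)\to0$ as $N\to\infty$. Strong MOMO property of $(X,T)$ relatively to $\boldsymbol{u}$: for every increasing sequence of integers $0=b_0<b_1<b_2<\cdots$ with $b_{k+1}-b_k\to\infty$, every sequence $(x_k)$ in $X$ and every $f\in C(X)$, $$\frac1{b_K}\sum_{k<K}\Bigl|\sum_{b_k\le n<b_{k+1}}f(T^{n-b_k}x_k)\boldsymbol{u}(n)\Bigr|\to0\quad (K\to\infty).$$ Sarnak's conjecture is the statement that every topological dynamical system of zero topological entropy has the Sarnak property relatively to $\boldsymbol{\mu}$. *)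

(* Defs.v *)
From HB Require Import structures.
From mathcomp Require Import all_boot all_order all_algebra.
From mathcomp Require Import complex.
From mathcomp Require Import all_classical all_reals all_analysis.

Set Implicit Arguments.
Unset Strict Implicit.
Unset Printing Implicit Defensive.

Import Order.TTheory GRing.Theory Num.Theory numFieldNormedType.Exports.

Local Open Scope classical_set_scope.
Local Open Scope ring_scope.

Definition dynamical_system (R : realType) (X : metricType R) (T : X -> X) :
    Prop :=
  compact [set: X] /\ continuous T.

Section Entropy.
Context (R : realType) (X : metricType R) (T : X -> X).

(* Bowen's definition of entropy: [s] is (n, e)-spanning, that is, an e-net for
   the metric max_(i < n) d(T^i x, T^i y). *)
Definition spanning (n : nat) (e : R) (s : seq X) : Prop :=
  forall y : X, exists2 x : X, x \in s &
    forall i : nat, (i < n)%N -> mdist (iter i T x) (iter i T y) < e.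

(* Infimum of a set of naturals, hence a minimum when the set is nonempty
   (always the case for a dynamical system), and +oo otherwise. *)
Definition spanning_number (n : nat) (e : R) : \bar R :=
  ereal_inf [set ((size s)%:R)%:E | s in spanning n e].

(* [entropy_at e] is nonincreasing in [e], so the supremum over e > 0 is the
   limit as e tends to 0.  The empty system gets entropy -oo. *)
Definition entropy_at (e : R) : \bar R :=
  limn_esup (fun n : nat => (n%:R^-1)%:E * lne (spanning_number n e))%E.

Definition topological_entropy : \bar R :=
  ereal_sup [set entropy_at e | e in [set e : R | 0 < e]].

End Entropy.

(* In both properties below the codomain R[i] carries the topology of the
   modulus, which the library attaches to its alias (R[i])^o. *)
Section Properties.
Context (R : realType) (X : metricType R) (T : X -> X) (u : nat -> R[i]).

Definition sarnak_property : Prop :=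
  forall (x : X) (f : X -> R[i]), continuous (f : X -> (R[i])^o) ->
    (N%:R^-1 * \sum_(0 <= n < N) f (iter n T x) * u n : (R[i])^o)
      @[N --> \oo] --> (0 : (R[i])^o).

Definition strong_MOMO_property : Prop :=
  forall b : nat -> nat,
    b 0%N = 0%N -> (forall k : nat, (b k < b k.+1)%N) ->
    (b k.+1 - b k)%N @[k --> \oo] --> \oo ->
  forall (x : nat -> X) (f : X -> R[i]), continuous (f : X -> (R[i])^o) ->
    ((b K)%:R^-1 *
      \sum_(0 <= k < K)
        `| \sum_(b k <= n < b k.+1) f (iter (n - b k) T (x k)) * u n |
      : (R[i])^o)
      @[K --> \oo] --> (0 : (R[i])^o).

End Properties.

(* Set to 0 at n = 0. *)
Definition mobius (n : nat) : int :=
  if (0 < n)%N && all (fun p : nat => ~~ (p ^ 2 %| n)%N) (primes n)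
  then (-1) ^+ size (primes n) else 0.

Definition complex_mobius (R : realType) (n : nat) : R[i] := (mobius n)%:~R.

Definition sarnak_conjecture (R : realType) : Prop :=
  forall (X : metricType R) (T : X -> X), dynamical_system T ->
    topological_entropy T = 0%E -> sarnak_property T (complex_mobius R).

(* Main.v *)
(** For (b) => (a): the N with a large average of f(T^n x) u(n) can be taken as
    the block ends b_k, with x_k = T^(b_k) x.
    For (a) => (b): write S_k for the k-th block sum.  For each sequence of bits
    a_k, consider the sequence y that lists the points T^(n - b_k) x_k marked by
    a_k, and the shift on its orbit closure Y.  A window of length G of y, far
    enough, meets at most two blocks, so up to an error e it is coded by the
    position of the switch, two elements of a (G, e)-spanning set of X and two
    bits: the number of codes is subexponential in G, and Y has entropy zero.  The
    Sarnak property of Y at y gives (1 / b_K) sum_(k < K) a_k S_k -> 0.  Selecting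
    by a the indices where the real (or imaginary) part of S_k is nonnegative (or
    negative) yields the same for the sum of the |S_k|. *)

Require Import Defs.
From mathcomp Require Import all_boot all_order all_algebra.
From mathcomp Require Import complex.
From mathcomp Require Import all_classical all_reals all_analysis.

From HB Require Import structures.
From mathcomp Require Import zify ring lra.

Set Implicit Arguments.
Unset Strict Implicit.
Unset Printing Implicit Defensive.

Import Order.TTheory GRing.Theory Num.Theory numFieldNormedType.Exports.

Local Open Scope classical_set_scope.
Local Open Scope ring_scope.

(** * Continuity in terms of distances *)

Section MetricContinuity.
Context (R : realType) (X Y : metricType R).

Lemma near_mdist (x : X) e : 0 < e -> nbhs x [set x' | mdist x x' < e].
Proof. by move=> e0; have := near_ball x e e0; rewrite ballEmdist. Qed.

Lemma continuous_mdist (f : X -> Y) :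
  (forall x e, 0 < e -> \forall x' \near x, mdist (f x) (f x') < e) ->
  continuous f.
Proof. by move=> fc x; apply/metricType_numDomainType.cvgrPdist_lt/fc. Qed.

End MetricContinuity.

Lemma continuous_norm (K : numFieldType) (V : normedModType K)
    (X : topologicalType) (f : X -> V) :
  (forall x e, 0 < e -> \forall x' \near x, `|f x - f x'| < e) -> continuous f.
Proof. by move=> fc x; apply/cvgrPdist_lt/fc. Qed.

(** * Zero entropy as subexponential growth of spanning sets *)

Section Entropy.
Context (R : realType) (X : metricType R) (T : X -> X).

(** Zero entropy in a form free of limits superior and extended logarithms, used both for [T] and
    for the shift built from it. *)
Definition subexponential_spanning : Prop :=
  forall e d : R, 0 < e -> 0 < d ->
    \forall n \near \oo,
      exists2 s, spanning T n e s & (size s)%:R <= expR (d * n%:R).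

Lemma subexponential_spanning_of_entropy0 :
  topological_entropy T = 0%E -> subexponential_spanning.
Proof.
move=> T0 e d e0 d0.
(* [limn_esup] is the infimum, over the sets V of the filter at infinity, of the supremum over V. *)
have /ereal_inf_lt[_ [V nV <-] Vd] : (entropy_at T e < d%:E)%E.
  apply: (@le_lt_trans _ _ 0%E); last by rewrite lte_fin.
  by rewrite -T0; apply: ereal_sup_ubound; exists e.
near=> n.
have n0 : (0 < n)%N by near: n; exact: nbhs_infty_gt.
have Vn : V n by near: n.
have : ((n%:R^-1)%:E * lne (spanning_number T n e) < d%:E)%E.
  by apply: le_lt_trans Vd; apply: ereal_sup_ubound; exists n.
rewrite lte_pdivrMl ?ltr0n// muleC => lned.
have /ereal_inf_lt[_ [s sp <-]] :
    (spanning_number T n e < (expR (d * n%:R))%:E)%E.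
  rewrite ltNge; apply/negP => le_sp; move: lned; rewrite ltNge => /negP; apply.
  rewrite -[X in (X <= _)%E](expeRK) lee_lne ?in_itv/= ?leey ?andbT//.
  by apply: le_trans le_sp; rewrite lee_fin expR_ge0.
by rewrite lte_fin => /ltW ?; exists s.
Unshelve. all: by end_near. Qed.

(** The point [x0] excludes the empty system, of entropy -oo: it makes every spanning set nonempty,
    so the logarithms are nonnegative. *)
Lemma entropy0_of_subexponential_spanning (x0 : X) :
  subexponential_spanning -> topological_entropy T = 0%E.
Proof.
move=> subT; have sn1 n e : (1 <= spanning_number T n e)%E.
  apply: le_ereal_inf_tmp => _ [s sp <-]; rewrite lee_fin ler1n.
  by have [x + _] := sp x0; case: s {sp}.
have ent_ge0 e : (0 <= entropy_at T e)%E.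
  apply: limf_esup_ge0 => [|n]; first exact: filter_not_empty.
  by rewrite mule_ge0 ?lee_fin ?invr_ge0 ?lne_ge0.
apply/eqP; rewrite eq_le; apply/andP; split; last first.
  by apply: le_trans (ent_ge0 1) _; apply: ereal_sup_ubound; exists 1 => /=.
apply: ge_ereal_sup => _ [e /= e0 <-]; apply/lee_addgt0Pr => d d0; rewrite add0e.
(* The limit superior is at most the supremum over any set of the filter; the set taken here is that
   of the n whose quotient is at most [d]. *)
apply: (@le_trans _ _ (ereal_sup
  ((fun n => ((n%:R^-1)%:E * lne (spanning_number T n e))%E) @`
   [set n | (n%:R^-1)%:E * lne (spanning_number T n e) <= d%:E]%E))); last first.
  by apply: ge_ereal_sup => _ [n /= ? <-].
apply: ereal_inf_lbound; eexists; last reflexivity.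
near=> n; rewrite /=.
have n0 : (0 < n)%N by near: n; exact: nbhs_infty_gt.
have [s sp les] : exists2 s, spanning T n e s & (size s)%:R <= expR (d * n%:R).
  by near: n; exact: subT.
rewrite lee_pdivrMl ?ltr0n// muleC.
rewrite -[leRHS]expeRK lee_lne ?in_itv/= ?leey ?andbT ?lee_fin ?expR_ge0//.
  by apply: (@le_trans _ _ (size s)%:R%:E); [apply: ereal_inf_lbound; exists s|
    rewrite lee_fin].
by apply: le_trans (sn1 n e).
Unshelve. all: by end_near. Qed.

End Entropy.

(** * The alphabet of marked points *)

Section Letters.
Context (R : realType) (X : metricType R).

(** The marks carry the discrete metric, so letters at distance below 1 have the same mark. *)
Definition letter_dist (p q : X * bool) : R :=
  mdist p.1 q.1 + (p.2 != q.2)%:R.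

Lemma letter_dist_ge0 p q : 0 <= letter_dist p q.
Proof. by rewrite addr_ge0 ?mdist_ge0. Qed.

Lemma letter_distxx p : letter_dist p p = 0.
Proof. by rewrite /letter_dist mdistxx eqxx addr0. Qed.

Lemma letter_dist_eq0 p q : letter_dist p q = 0 -> p = q.
Proof.
move=> /eqP; rewrite paddr_eq0 ?mdist_ge0//.
case: p q => [x a] [y b] /= /andP[/eqP/mdist_positivity -> ].
by rewrite pnatr_eq0 eqb0 negbK => /eqP ->.
Qed.

Lemma letter_dist_sym p q : letter_dist p q = letter_dist q p.
Proof. by rewrite /letter_dist metric_sym eq_sym. Qed.

Lemma letter_dist_triangle q p r :
  letter_dist p r <= letter_dist p q + letter_dist q r.
Proof.
rewrite /letter_dist addrACA lerD ?metric_triangle//.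
by case: p q r => [? []] [? []] [? []] /=; lra.
Qed.

(** Compactness gives a cluster point of the first components, and an ultrafilter converges to its
    cluster points; it also decides between the two marks. *)
Lemma ultra_letter_cvg (I : Type) (F : set_system I) (h : I -> X * bool) :
  compact [set: X] -> UltraFilter F ->
  exists p, forall e, 0 < e -> F [set i | letter_dist p (h i) < e].
Proof.
move=> cX FU; have FP : ProperFilter F := ultra_proper.
have [x [_ Fx]] := cX [eta (fst \o h) @ F] _ filterT.
have Fball e : 0 < e -> F [set i | mdist x (h i).1 < e].
  move=> e0; have [//|nF] := in_ultra_setVsetC [set i | mdist x (h i).1 < e] FU.
  have := Fx (~` [set y | mdist x y < e]) (ball x e) nF (nbhsx_ballx _ _ e0).
  by rewrite ballEmdist => -[y []].
have [b Fb] : exists b, F [set i | (h i).2 = b].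
  have [Ft|Ff] := in_ultra_setVsetC [set i | (h i).2 = true] FU.
    by exists true.
  by exists false; apply: filterS Ff => i /=; case: (h i).2.
exists (x, b) => e /Fball; apply: filterS2 Fb => i /= <-.
by rewrite /letter_dist eqxx addr0.
Qed.

End Letters.

(** * The shift on the orbit closure of a sequence *)

Section OrbitClosure.
Context (R : realType) (X : metricType R) (y : nat -> X * bool).

(* The closure of the shift orbit of [y] in the product topology. *)
Record orbit_closure := OrbitClosure {
  letter :> nat -> X * bool;
  letterP : forall N (e : R), 0 < e ->
    exists m, forall n, (n < N)%N -> letter_dist (letter n) (y (m + n)%N) < e }.

Implicit Types (z w v : orbit_closure) (e : R).

Lemma letter_inj z w : letter z =1 letter w -> z = w.
Proof.
case: z w => [z zP] [w wP] /= /funext zw; rewrite -zw in wP *.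
by congr OrbitClosure; exact: Prop_irrelevance.
Qed.

HB.instance Definition _ := gen_eqMixin orbit_closure.
HB.instance Definition _ := gen_choiceMixin orbit_closure.

(** The cap 1/(n+1) makes far letters negligible, so this metrizes the product topology. *)
Definition seq_dist (z w : orbit_closure) : R :=
  sup (range (fun n => Num.min (letter_dist (z n) (w n)) n.+1%:R^-1)).

Lemma seq_dist_le z w e :
  (forall n, Num.min (letter_dist (z n) (w n)) n.+1%:R^-1 <= e) ->
  seq_dist z w <= e.
Proof.
move=> le_e; apply: ge_sup => [|_ [n _ <-]]; last exact: le_e.
by eexists; exists 0%N.
Qed.

Lemma le_seq_dist z w n :
  Num.min (letter_dist (z n) (w n)) n.+1%:R^-1 <= seq_dist z w.
Proof.
apply: ub_le_sup; last by exists n.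
exists 1 => _ [k _ <-]; rewrite ge_min invf_le1 ?ltr0n//.
by rewrite ler1n orbT.
Qed.

Lemma seq_dist_le_near z w N e :
  (forall n, (n < N)%N -> letter_dist (z n) (w n) <= e) -> N.+1%:R^-1 <= e ->
  seq_dist z w <= e.
Proof.
move=> zw Ne; apply: seq_dist_le => n; rewrite ge_min.
have [/zw ->//|Nn] := ltnP n N; apply/orP; right; apply: le_trans Ne.
by rewrite lef_pV2 ?posrE ?ltr0n// ler_nat.
Qed.

Lemma letter_dist_le z w n : seq_dist z w < n.+1%:R^-1 ->
  letter_dist (z n) (w n) <= seq_dist z w.
Proof.
move=> zw; have := le_seq_dist z w n; rewrite ge_min => /orP[//|].
by rewrite leNgt zw.
Qed.

Lemma seq_distxx z : seq_dist z z = 0.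
Proof.
apply/eqP; rewrite eq_le seq_dist_le/=; last first.
  by move=> n; rewrite letter_distxx ge_min lexx.
apply: le_trans (le_seq_dist z z 0).
by rewrite le_min letter_dist_ge0 invr_ge0 ler0n.
Qed.

Lemma seq_dist_eq0 z w : seq_dist z w = 0 -> z = w.
Proof.
move=> zw; apply: letter_inj => n; apply: letter_dist_eq0; apply/eqP.
rewrite eq_le letter_dist_ge0 andbT -zw letter_dist_le// zw.
by rewrite invr_gt0 ltr0n.
Qed.

Lemma seq_dist_sym z w : seq_dist z w = seq_dist w z.
Proof.
by rewrite /seq_dist; under eq_fun do rewrite letter_dist_sym.
Qed.

Lemma seq_dist_triangle w z v : seq_dist z v <= seq_dist z w + seq_dist w v.
Proof.
apply: seq_dist_le => n.
apply: le_trans (lerD (le_seq_dist z w n) (le_seq_dist w v n)).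
have := letter_dist_triangle (w n) (z n) (v n).
have := letter_dist_ge0 (z n) (w n); have := letter_dist_ge0 (w n) (v n).
have : 0 <= n.+1%:R^-1 :> R by rewrite invr_ge0.
move: (letter_dist _ _) (letter_dist _ _) (letter_dist _ _) (_^-1) => a b c d.
by rewrite !minEle; do 3![case: ifPn; rewrite -?ltNge]=> *; lra.
Qed.

HB.instance Definition _ := @isMetric.Build R orbit_closure seq_dist
  seq_distxx seq_dist_eq0 seq_dist_sym seq_dist_triangle.

Lemma orbit_mdistE z w : mdist z w = seq_dist z w.
Proof. by []. Qed.

(** An ultrafilter converges in each coordinate, hence on any finite window. The limit sequence
    stays in the closure: on a window it is e/2-close to some [w], which is e/2-close to a window of
    [y]. *)
Lemma orbit_closure_compact : compact [set: X] -> compact [set: orbit_closure].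
Proof.
move=> cX; rewrite compact_ultra => F FU _.
have FP : ProperFilter F := ultra_proper.
have [z zF] := choice (fun n => ultra_letter_cvg (fun w : orbit_closure => w n) cX FU).
have near_z N e : 0 < e ->
    F [set w : orbit_closure | forall n, (n < N)%N -> letter_dist (z n) (w n) < e].
  move=> e0; elim: N => [|N IH]; first by apply: filterS filterT => w _.
  apply: filterS2 IH (zF N e e0) => w /= wN wNe n; rewrite ltnS leq_eqVlt.
  by move=> /orP[/eqP ->|/wN].
have zP N e : 0 < e ->
    exists m, forall n, (n < N)%N -> letter_dist (z n) (y (m + n)%N) < e.
  move=> e0; have e20 : 0 < e / 2 by rewrite divr_gt0.
  have [w /= wz] := filter_ex (near_z N _ e20).
  have [m wy] := letterP w N e20; exists m => n nN.
  apply: le_lt_trans (letter_dist_triangle (w n) _ _) _.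
  by rewrite [ltRHS](splitr e) ltrD ?wz ?wy.
exists (OrbitClosure zP); split => //.
apply/metricType_numDomainType.fcvgrPdist_lt => e e0.
have e20 : 0 < e / 2 by rewrite divr_gt0.
near \oo => N.
apply: filterS (near_z N _ e20) => w /= wz.
apply: (@le_lt_trans _ _ (e / 2)); last by rewrite ltr_pdivrMr// ltr_pMr// ltr1n.
apply: (@seq_dist_le_near _ _ N) => [n /wz /ltW//|].
by apply: ltW; near: N; exact: near_infty_natSinv_lt (PosNum e20).
Unshelve. all: by end_near. Qed.

Lemma shift_subproof (z : orbit_closure) N (e : R) : 0 < e ->
  exists m, forall n, (n < N)%N -> letter_dist (z n.+1) (y (m + n)%N) < e.
Proof.
move=> e0; have [m zy] := letterP z N.+1 e0; exists m.+1 => n nN.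
by rewrite addSnnS zy.
Qed.

Definition shift (z : orbit_closure) := OrbitClosure (shift_subproof z).

Lemma iter_shiftE i z n : iter i shift z n = z (n + i)%N.
Proof. by elim: i n => [|i IH] n; rewrite ?addn0//= IH addSnnS. Qed.

(** Letter n + 1 moves to place n, and the caps satisfy 1/(n+1) <= 2/(n+2). *)
Lemma seq_dist_shift z w : seq_dist (shift z) (shift w) <= 2 * seq_dist z w.
Proof.
apply: seq_dist_le => n.
apply: le_trans (ler_wpM2l _ (le_seq_dist z w n.+1)) => //=.
have := letter_dist_ge0 (z n.+1) (w n.+1).
have : n.+1%:R^-1 <= 2 * n.+2%:R^-1 :> R.
  rewrite -[2]invrK -invfM lef_pV2 ?posrE ?mulr_gt0 ?invr_gt0//.
  by rewrite ler_pdivrMl// -natrM ler_nat; lia.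
move: (letter_dist _ _) (n.+1%:R^-1) (n.+2%:R^-1) => a b c.
by rewrite !minEle; do 2![case: ifPn; rewrite -?ltNge]=> *; lra.
Qed.

Lemma shift_continuous : continuous shift.
Proof.
apply: continuous_mdist => z e e0; have e20 : 0 < e / 2 by rewrite divr_gt0.
near=> w; apply: le_lt_trans (seq_dist_shift z w) _.
rewrite mulrC -ltr_pdivlMr// -orbit_mdistE; near: w.
exact: near_mdist.
Unshelve. all: by end_near. Qed.

Lemma base_point_subproof N (e : R) : 0 < e ->
  exists m, forall n, (n < N)%N -> letter_dist (y n) (y (m + n)%N) < e.
Proof. by move=> e0; exists 0%N => n _; rewrite letter_distxx. Qed.

Definition base_point := OrbitClosure base_point_subproof.

Lemma near_letter n (z : orbit_closure) e : 0 < e ->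
  \forall w \near z, letter_dist (z n) (letter w n) < e.
Proof.
move=> e0; near=> w.
have zw : mdist z w < Num.min e n.+1%:R^-1.
  near: w; apply: near_mdist.
  by rewrite lt_min e0 invr_gt0 ltr0n.
move: zw; rewrite lt_min => /andP[zwe /letter_dist_le/le_lt_trans]; exact.
Unshelve. all: by end_near. Qed.

End OrbitClosure.

(** * Spanning sets from codes, and growth estimates *)

Lemma spanning_of_code (R : realType) (Y : metricType R) (S : Y -> Y) (n : nat)
    (e : R) (C : finType) (code : Y -> C -> Prop) :
    (forall z, exists c, code z c) ->
    (forall c z w, code z c -> code w c ->
      forall i, (i < n)%N -> mdist (iter i S z) (iter i S w) < e) ->
  exists2 s, spanning S n e s & (size s <= #|C|)%N.
Proof.
move=> codeT code_close.
(* One representative for each code that occurs: any point is [e]-close to the representative of any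
   of its codes. *)
pose rep c := if pselect (exists z, code z c) is left h then Some (projT1 (cid h))
              else None.
exists (pmap rep (enum C)); last by rewrite size_pmap cardE count_size.
move=> w; have [c wc] := codeT w.
have [z zc repc] : exists2 z, code z c & rep c = Some z.
  rewrite /rep; case: pselect => [h|[]]; last by exists w.
  by exists (projT1 (cid h)) => //; case: cid.
exists z; last exact: code_close zc wc.
by rewrite mem_pmap -repc map_f// mem_enum.
Qed.

Lemma near_expR_ge (R : realType) (A d : R) : 0 < d ->
  \forall n \near \oo, A <= expR (d * n%:R).
Proof.
move=> d0; near=> n.
have An : A / d <= n%:R by near: n; exact: nbhs_infty_ger.
apply: le_trans (expR_ge1Dx _); rewrite ler_pdivrMr// mulrC in An.
by rewrite (le_trans An)// lerDr.
Unshelve. all: by end_near. Qed.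

Lemma near_linear_le_expR (R : realType) (A d : R) : 0 < A -> 0 < d ->
  \forall n \near \oo, A * n.+1%:R <= expR (d * n%:R).
Proof.
move=> A0 d0; have d20 : 0 < d / 2 by rewrite divr_gt0.
(* Half of the exponent absorbs this constant; the other half gives the factor 1 + dn/2, and (1 +
   2/d)(1 + dn/2) >= 1 + n. *)
have K0 : 0 < A * (1 + 2 / d) by rewrite mulr_gt0 ?addr_gt0 ?divr_gt0.
near=> n.
have Kn : A * (1 + 2 / d) <= expR (d / 2 * n%:R) by near: n; exact: near_expR_ge.
rewrite [d * _](_ : _ = d / 2 * n%:R + d / 2 * n%:R); last by field.
apply: (@le_trans _ _ (A * (1 + 2 / d) * (1 + d / 2 * n%:R))).
  rewrite -mulrA ler_pM2l// -natr1 addrC.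
  have -> : (1 + 2 / d) * (1 + d / 2 * n%:R) = 1 + n%:R + (2 / d + d / 2 * n%:R).
    by field; rewrite gt_eqF.
  by rewrite lerDl addr_ge0 ?mulr_ge0 ?invr_ge0 ?ler0n ?(ltW d0).
rewrite expRD ler_pM ?expR_ge1Dx ?(ltW K0)//.
by rewrite addr_ge0 ?mulr_ge0 ?invr_ge0 ?ler0n ?(ltW d0).
Unshelve. all: by end_near. Qed.

(** Here [c] counts the codes of a window of length [G], the exponent is a number of windows
    covering n + [L] letters, and [M] counts exceptional codes. Rounding costs a constant factor
    [A], and M + A is absorbed by doubling the rate. *)
Lemma near_block_code_le (R : realType) (M c G L : nat) (d : R) :
    0 < d -> (0 < G)%N -> c%:R <= expR (d * G%:R) ->
  \forall n \near \oo,
    (M + c ^ ((n + L) %/ G).+1)%:R <= expR (2 * d * n%:R).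
Proof.
move=> d0 G0 cG; set A := expR (d * (L + G)%:R); near=> n.
have MA : M%:R + A <= expR (d * n%:R) by near: n; exact: near_expR_ge.
have cq : (c ^ ((n + L) %/ G).+1)%:R <= A * expR (d * n%:R).
  rewrite natrX; apply: (@le_trans _ _ (expR (d * G%:R) ^+ ((n + L) %/ G).+1)).
    by rewrite lerXn2r ?nnegrE ?expR_ge0.
  rewrite -expRM_natr -expRD ler_expR -!mulrA -mulrDr ler_wpM2l ?(ltW d0)//.
  rewrite -natrM -natrD ler_nat mulnS mulnC.
  by have := leq_divM (n + L) G; lia.
rewrite natrD -mulrA mulr2n mulrDl mul1r expRD.
apply: le_trans (ler_wpM2r (expR_ge0 _) MA).
rewrite mulrDl lerD// ler_peMr//.
by rewrite -expR0 ler_expR mulr_ge0// ltW.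
Unshelve. all: by end_near. Qed.

(** * Zero entropy for sequences of long orbit segments *)

Section SwitchEntropy.
Context (R : realType) (X : metricType R) (T : X -> X) (y : nat -> X * bool).

Definition one_switch_word (p : nat) (a a' : X * bool) (i : nat) : X * bool :=
  if (i < p)%N then (iter i T a.1, a.2) else (iter (i - p) T a'.1, a'.2).

(* Only for [m >= M]: the lengths of the orbit segments of [y] tend to infinity, but
   the first ones may be short. *)
Definition eventually_one_switch : Prop :=
  forall G, exists M, forall m, (M <= m)%N ->
    exists p a a', (p <= G)%N /\
      forall i, (i < G)%N -> y (m + i)%N = one_switch_word p a a' i.

Hypothesis y_switch : eventually_one_switch.

(** Both 0 and [G] are allowed as switch positions: they stand for windows within a single orbit
    segment. *)
Definition code (k G : nat) : finType := ('I_G.+1 * (('I_k * bool) * ('I_k * bool)))%type.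

Definition decode (s : seq X) G (c : code (size s) G) : nat -> X * bool :=
  one_switch_word c.1 (tnth (in_tuple s) c.2.1.1, c.2.1.2)
                      (tnth (in_tuple s) c.2.2.1, c.2.2.2).

(** Wherever the switch is, each of the two segments runs for at most [G] steps, within the range
    that the spanning set controls. *)
Lemma decode_one_switch s G e p (a a' : X * bool) : spanning T G e s ->
  (p <= G)%N -> exists c : code (size s) G, forall i, (i < G)%N ->
    letter_dist (decode c i) (one_switch_word p a a' i) < e.
Proof.
move=> sp pG.
have near_a (x : X) : exists j : 'I_(size s), forall i, (i < G)%N ->
    mdist (iter i T (tnth (in_tuple s) j)) (iter i T x) < e.
  have [x' sx' ?] := sp x.
  have /tnthP[j jx'] : x' \in in_tuple s by [].
  by exists j; rewrite -jx'.
have [j ja] := near_a a.1; have [j' ja'] := near_a a'.1.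
exists (Ordinal (pG : (p < G.+1)%N), ((j, a.2), (j', a'.2))) => i iG.
rewrite /decode /one_switch_word /=; case: ifPn => ip.
  by rewrite /letter_dist eqxx addr0 ja.
by rewrite /letter_dist eqxx addr0 ja'// (leq_ltn_trans _ iG) ?leq_subr.
Qed.

(** A point is [e]-close to a window of [y]. A window starting before [M] is coded by its start; a
    later one is cut into [q] pieces with one switch each. As [M] is chosen before [q], the first
    kind of code does not affect the growth rate. *)
Lemma switch_code s G e : (0 < G)%N -> 0 < e -> spanning T G e s ->
  exists M, forall q, exists
    codes : orbit_closure y -> 'I_M + {ffun 'I_q -> code (size s) G} -> Prop,
    (forall z, exists c, codes z c) /\
    (forall c z w, codes z c -> codes w c -> forall i, (i < q * G)%N ->
      letter_dist (z i) (w i) < 4 * e).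
Proof.
move=> G0 e0 sp; have [M yM] := y_switch G; exists M => q.
exists (fun (z : orbit_closure y) (c : 'I_M + {ffun 'I_q -> code (size s) G}) =>
  match c with
  | inl m => forall i, (i < q * G)%N -> letter_dist (y (m + i)%N) (z i) < 2 * e
  | inr c => forall (l : 'I_q) i, (i < G)%N ->
      letter_dist (decode (c l) i) (z (l * G + i)%N) < 2 * e
  end); split => [z|].
  have [m zm] := letterP z (q * G) e0.
  have [mM|Mm] := ltnP m M.
    exists (inl (Ordinal mM)) => i iq; rewrite letter_dist_sym.
    by apply: lt_trans (zm i iq) _; rewrite mulr_natl mulr2n ltrDl.
  have /choice[c cl] (l : 'I_q) : exists c : code (size s) G,
      forall i, (i < G)%N -> letter_dist (decode c i) (y (m + (l * G + i))%N) < e.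
    have [|p [a [a' [pG yl]]]] := yM (m + l * G)%N; first exact: leq_trans (leq_addr _ _).
    have [c ca] := decode_one_switch a a' sp pG.
    by exists c => i iG; rewrite addnA yl// ca.
  exists (inr [ffun l => c l]) => l i iG; rewrite ffunE.
  apply: le_lt_trans (letter_dist_triangle (y (m + (l * G + i))%N) _ _) _.
  rewrite mulr_natl mulr2n ltrD ?cl// letter_dist_sym zm//.
  have: (l.+1 * G <= q * G)%N by rewrite leq_mul2r ltn_ord orbT.
  by rewrite mulSn; lia.
have four_e : 4 * e = 2 * e + 2 * e by ring.
case=> [m|c] z w zc wc i iq.
  apply: le_lt_trans (letter_dist_triangle (y (m + i)%N) _ _) _.
  by rewrite four_e ltrD ?wc// letter_dist_sym zc.
have lq : (i %/ G < q)%N by rewrite ltn_divLR.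
have iG : (i %% G < G)%N by rewrite ltn_mod.
move: (zc (Ordinal lq) _ iG) (wc (Ordinal lq) _ iG); rewrite /= -divn_eq => zi wi.
rewrite four_e; apply: le_lt_trans (ltrD _ wi).
  by apply: letter_dist_triangle.
by rewrite letter_dist_sym.
Qed.

Lemma subexponential_spanning_shift :
  subexponential_spanning T -> subexponential_spanning (@shift R X y).
Proof.
move=> subT e d e0 d0.
(* Codes determine letters up to 4(e/8) = e/2. The factor 4(G + 1) and the two choices in [s] each
   cost exp(dG/6), together exp(dG/2), and the passage to long windows doubles this rate. *)
have e80 : 0 < e / 8 by rewrite divr_gt0.
have d60 : 0 < d / 6 by rewrite divr_gt0.
near \oo => G.
have G0 : (0 < G)%N by near: G; exact: nbhs_infty_gt.
have [s sp sG] : exists2 s, spanning T G (e / 8) s & (size s)%:R <= expR (d / 6 * G%:R).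
  by near: G; exact: subT.
have G4 : 4 * G.+1%:R <= expR (d / 6 * G%:R) by near: G; exact: near_linear_le_expR.
have [M Mcode] := switch_code G0 e80 sp.
(* Comparing the shifts by i < n takes [L] letters beyond each such i; the remaining letters are
   capped by e/2. *)
have [L Le] : exists L, L.+1%:R^-1 <= e / 2.
  have e20 : 0 < e / 2 by rewrite divr_gt0.
  near \oo => L; exists L; apply: ltW; near: L.
  exact: near_infty_natSinv_lt (PosNum e20).
pose c := #|{: code (size s) G}|.
have cG : c%:R <= expR (d / 2 * G%:R).
  rewrite /c !card_prod !card_ord card_bool.
  rewrite [(_ * _)%N](_ : _ = 4 * G.+1 * size s * size s)%N; last by ring.
  rewrite !natrM.
  have -> : d / 2 * G%:R = d / 6 * G%:R + d / 6 * G%:R + d / 6 * G%:R by field.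
  by rewrite !expRD !ler_pM.
have d20 : 0 < d / 2 by rewrite divr_gt0.
have := near_block_code_le M L d20 G0 cG.
rewrite (_ : 2 * (d / 2) = d); last by field.
apply: filterS => n; set q := ((n + L) %/ G).+1 => le_cq.
have [codes [codesT codes_close]] := Mcode q.
have nq : (n + L <= q * G)%N.
  by rewrite /q mulSn {1}(divn_eq (n + L) G) addnC leq_add2r ltnW// ltn_mod.
have [zs spz le_zs] : exists2 zs, spanning (@shift R X y) n e zs &
    (size zs <= #|{: 'I_M + {ffun 'I_q -> code (size s) G}}|)%N.
  apply: spanning_of_code codesT _ => ? z w zc wc i iN; rewrite orbit_mdistE.
  apply: (@le_lt_trans _ _ (e / 2)); last by rewrite ltr_pdivrMr// ltr_pMr// ltr1n.
  apply: seq_dist_le_near Le => k kL; rewrite !iter_shiftE.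
  have -> : e / 2 = 4 * (e / 8) by field.
  by apply/ltW/(codes_close _ _ _ zc wc)/(leq_trans _ nq); lia.
exists zs => //; apply: le_trans le_cq.
by rewrite ler_nat (leq_trans le_zs)// card_sum card_ord card_ffun card_ord.
Unshelve. all: by end_near. Qed.

End SwitchEntropy.

(** * Partition of the integers into blocks *)

Section Blocks.
Variable b : nat -> nat.
Hypotheses (b0 : b 0%N = 0%N) (b_incr : forall k, (b k < b k.+1)%N).

Lemma block_mono : {mono b : j k / (j <= k)%N}.
Proof. exact: leq_mono (homo_ltn ltn_trans b_incr). Qed.

Lemma leq_block k : (k <= b k)%N.
Proof. by elim: k => // k IH; apply: leq_ltn_trans IH (b_incr k). Qed.

Lemma exists_block : exists blk : nat -> nat,
  forall n k, (b k <= n < b k.+1)%N = (blk n == k).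
Proof.
have /choice[blk blkP] n : exists k, (b k <= n < b k.+1)%N.
  elim: n => [|n [k /andP[kn nk]]]; first by exists 0%N; have := b_incr 0%N; lia.
  have [lt_nk|] := ltnP n.+1 (b k.+1); first by exists k; rewrite lt_nk ltnW.
  by exists k.+1; have := b_incr k.+1; lia.
exists blk => n k; apply/idP/eqP => [/andP[kn nk]|<- //].
have /andP[bn nb] := blkP n; apply/anti_leq/andP.
by split; rewrite -ltnS -(leqW_mono block_mono);
  [exact: leq_ltn_trans bn nk|exact: leq_ltn_trans kn nb].
Qed.

Lemma big_blocks (V : zmodType) (F : nat -> V) K :
  \sum_(0 <= n < b K) F n = \sum_(0 <= k < K) \sum_(b k <= n < b k.+1) F n.
Proof.
elim: K => [|K IH]; first by rewrite b0 !big_geq.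
by rewrite big_nat_recr//= -IH -big_cat_nat// ltnW.
Qed.

End Blocks.

(** * Concatenation of marked orbit segments *)

Section Concatenation.
Context (R : realType) (X : metricType R) (T : X -> X) (b : nat -> nat).
Context (x : nat -> X) (a : nat -> bool) (blk : nat -> nat).
Hypotheses (b0 : b 0%N = 0%N) (b_incr : forall k, (b k < b k.+1)%N).
Hypothesis blkE : forall n k, (b k <= n < b k.+1)%N = (blk n == k).

Definition marked_orbits (n : nat) : X * bool :=
  (iter (n - b (blk n)) T (x (blk n)), a (blk n)).

Lemma marked_orbitsE n k : (b k <= n < b k.+1)%N ->
  marked_orbits n = (iter (n - b k) T (x k), a k).
Proof. by rewrite blkE /marked_orbits => /eqP ->. Qed.

(** Once block lengths are at least G, a window of length G starting in block k ends in block k or k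
    + 1, so it can only switch at [b k.+1]. *)
Lemma marked_orbits_switch :
  (b k.+1 - b k)%N @[k --> \oo] --> \oo -> eventually_one_switch T marked_orbits.
Proof.
move=> /cvgnyPge gap G; have [k0 _ k0G] := gap G.
exists (b k0) => m le_m; set k := blk m.
have /andP[km mk] : (b k <= m < b k.+1)%N by rewrite blkE.
have le_k0 : (k0 <= k)%N.
  by rewrite -ltnS -(leqW_mono (block_mono b_incr)) (leq_ltn_trans le_m).
have gapk : (G <= b k.+2 - b k.+1)%N by apply: k0G => /=; rewrite leqW.
(* The cap at [G] covers windows inside block k. The first segment starts at the point already
   reached at time [m]. *)
exists (minn (b k.+1 - m) G), (iter (m - b k) T (x k), a k), (x k.+1, a k.+1).
split=> [|i iG]; first exact: geq_minr.
rewrite /one_switch_word /= leq_min iG andbT; case: ltnP => im.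
  rewrite (@marked_orbitsE _ k); last by lia.
  by rewrite -iterD; congr (iter _ _ _, _); lia.
rewrite (@marked_orbitsE _ k.+1); last by lia.
by congr (iter _ _ _, _); lia.
Qed.

Definition marked_fun (C : zmodType) (f : X -> C) (z : orbit_closure marked_orbits) : C :=
  if (z 0%N).2 then f (z 0%N).1 else 0.

(** The mark of letter 0 is locally constant, so near a given point this is either f of a coordinate
    or 0. *)
Lemma marked_fun_continuous (C : normedModType R[i]) (f : X -> C) :
  continuous f -> continuous (marked_fun f).
Proof.
move=> fc; apply: continuous_norm => z e e0.
have /cvgrPdist_lt/(_ e e0)/nbhs_ballP[r /= r0 fr] := fc (z 0%N).1.
near=> w.
have zw0 : letter_dist (z 0%N) (letter w 0%N) < Num.min r 1.
  by near: w; apply: near_letter; rewrite lt_min r0 ltr01.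
move: zw0; rewrite lt_min /letter_dist => /andP[zwr zw1].
have z2 : (z 0%N).2 = (letter w 0%N).2.
  apply/eqP; apply: contraTT zw1 => ->; rewrite -leNgt lerDr mdist_ge0 //.
rewrite /marked_fun -z2; case: ifP => _; last by rewrite subrr normr0.
apply: fr; rewrite ballEmdist /=; apply: le_lt_trans zwr.
by rewrite lerDl.
Unshelve. all: by end_near. Qed.

(** The mark is constant on each block, hence factors out of the block sum. This turns a Sarnak sum
    for the shift into a selection of block sums. *)
Lemma marked_sum (f : X -> R[i]) (u : nat -> R[i]) K :
  \sum_(0 <= n < b K)
    marked_fun f (iter n (@shift R X _) (base_point marked_orbits)) * u n =
  \sum_(0 <= k < K) (a k)%:R *
    \sum_(b k <= n < b k.+1) f (iter (n - b k) T (x k)) * u n.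
Proof.
rewrite big_blocks//; apply: eq_bigr => k _; rewrite big_distrr/=.
apply: eq_big_nat => n /marked_orbitsE yn.
have -> : marked_fun f (iter n (@shift R X _) (base_point marked_orbits)) =
    if a k then f (iter (n - b k) T (x k)) else 0.
  by rewrite /marked_fun iter_shiftE add0n [letter _ n]yn.
by case: (a k); rewrite !(mul1r, mul0r).
Qed.

End Concatenation.

(** * Sums of moduli bounded by selected sums *)

Section Selection.
Context (C : numClosedFieldType) (S : nat -> C) (K : nat).

Definition selected_sum (a : nat -> bool) : C := \sum_(0 <= k < K) (a k)%:R * S k.

(** Used with c = 1 and c = 'i: as Re(iz) = -Im z, these select by the sign of the real and of the
    imaginary part. *)
Definition halfplane (c : C) (k : nat) : bool := 0 <= 'Re (c * S k).

(** The real part equals its absolute value on the half-plane and minus it elsewhere, so the left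
    side is the real part of c times the difference of the two selected sums. *)
Lemma sum_norm_Re_le (c : C) : `|c| = 1 ->
  \sum_(0 <= k < K) `|'Re (c * S k)| <=
  `|selected_sum (halfplane c)| +
  `|selected_sum (fun k => ~~ halfplane c k)|.
Proof.
move=> c1; set A := halfplane c; set B := fun k => ~~ A k.
have -> : \sum_(0 <= k < K) `|'Re (c * S k)| =
    'Re (c * (selected_sum A - selected_sum B)).
  rewrite /selected_sum -sumrB big_distrr raddf_sum; apply: eq_bigr => k _ /=.
  rewrite /B /A /halfplane; have [re0|re0] := boolP (0 <= 'Re (c * S k)).
    by rewrite mul1r mul0r subr0 ger0_norm.
  rewrite mul0r mul1r sub0r mulrN raddfN ltr0_norm//.
  by rewrite real_ltNge ?Creal_Re ?real0.
apply: (@le_trans _ _ `|c * (selected_sum A - selected_sum B)|).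
  apply: le_trans (leif_normC_Re_Creal _); exact: real_ler_norm (Creal_Re _).
by rewrite normrM c1 mul1r ler_normB.
Qed.

Lemma sum_norm_le :
  \sum_(0 <= k < K) `|S k| <=
  (`|selected_sum (halfplane 1)| +
   `|selected_sum (fun k => ~~ halfplane 1 k)|) +
  (`|selected_sum (halfplane 'i)| +
   `|selected_sum (fun k => ~~ halfplane 'i k)|).
Proof.
apply: le_trans (lerD (sum_norm_Re_le (normr1 C)) (sum_norm_Re_le (normCi C))).
rewrite -big_split; apply: ler_sum => k _ /=.
rewrite mul1r ReMil normrN {1}[S k]Crect (le_trans (ler_normD _ _))//.
by rewrite normrM normCi mul1r.
Qed.

Lemma mean_norm_lt (r e : C) :
  `|r * selected_sum (halfplane 1)| < e / 4 ->
  `|r * selected_sum (fun k => ~~ halfplane 1 k)| < e / 4 ->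
  `|r * selected_sum (halfplane 'i)| < e / 4 ->
  `|r * selected_sum (fun k => ~~ halfplane 'i k)| < e / 4 ->
  `|r * \sum_(0 <= k < K) `|S k| | < e.
Proof.
move=> r1 r2 r3 r4; rewrite normrM (@ger0_norm _ (\sum_(0 <= k < K) _)) ?sumr_ge0//.
apply: le_lt_trans (ler_wpM2l (normr_ge0 _) sum_norm_le) _.
have -> : e = e / 4 + e / 4 + (e / 4 + e / 4) by field.
by rewrite !mulrDr -!normrM !ltrD.
Qed.

End Selection.

(** * The two implications *)

Lemma strong_MOMO_of_sarnak (R : realType) (u : nat -> R[i]) :
  (forall (X : metricType R) (T : X -> X), dynamical_system T ->
     topological_entropy T = 0%E -> sarnak_property T u) ->
  forall (X : metricType R) (T : X -> X), dynamical_system T ->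
    topological_entropy T = 0%E -> strong_MOMO_property T u.
Proof.
move=> sarnak X T [cX cT] T0 b b0 b_incr gap x f cf.
have [blk blkE] := exists_block b0 b_incr.
pose S k := \sum_(b k <= n < b k.+1) f (iter (n - b k) T (x k)) * u n.
have selected a :
    ((b K)%:R^-1 * selected_sum S K a : (R[i])^o) @[K --> \oo] --> (0 : (R[i])^o).
  pose y := marked_orbits T b x a blk.
  have sw : eventually_one_switch T y by exact: marked_orbits_switch.
  have dynY : dynamical_system (@shift R X y).
    by split; [exact: orbit_closure_compact|exact: shift_continuous].
  have Y0 : topological_entropy (@shift R X y) = 0%E.
    apply: entropy0_of_subexponential_spanning; first exact: base_point.
    apply: subexponential_spanning_shift sw _.
    exact: subexponential_spanning_of_entropy0.
  have := sarnak _ _ dynY Y0 (base_point y) (marked_fun f)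
    (@marked_fun_continuous _ _ _ _ _ _ _ (R[i])^o f cf).
  have b_oo : b K @[K --> \oo] --> \oo.
    apply/cvgnyPge => A; near=> K; apply: leq_trans (leq_block b_incr K).
    by near: K; exact: nbhs_infty_ge.
  (* The Sarnak averages of the shift are taken along the subsequence N = [b K]. *)
  move=> /(cvg_comp _ _ b_oo); apply: cvg_trans; apply: near_eq_cvg.
  by apply: nearW => K /=; rewrite marked_sum.
apply/cvgr0Pnorm_lt => e e0; have e40 : 0 < e / 4 by rewrite divr_gt0.
have small a : \forall K \near \oo, `|(b K)%:R^-1 * selected_sum S K a| < e / 4.
  by have /cvgr0Pnorm_lt/(_ _ e40) := selected a.
have small2 a a' : \forall K \near \oo,
    `|(b K)%:R^-1 * selected_sum S K a| < e / 4 /\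
    `|(b K)%:R^-1 * selected_sum S K a'| < e / 4.
  by near=> K; split; near: K; exact: small.
(* The four bit sequences depend on [S] but not on K, so each defines one fixed system to which the
   Sarnak property applies. *)
have := small2 (halfplane S 1) (fun k => ~~ halfplane S 1 k).
apply: filterS2 (small2 (halfplane S 'i) (fun k => ~~ halfplane S 'i k)).
by move=> K [r3 r4] [r1 r2]; exact: mean_norm_lt r1 r2 r3 r4.
Unshelve. all: by end_near. Qed.

Lemma sarnak_of_strong_MOMO (R : realType) (X : metricType R) (T : X -> X)
    (u : nat -> R[i]) :
  strong_MOMO_property T u -> sarnak_property T u.
Proof.
move=> momo x f cf; pose A N := \sum_(0 <= n < N) f (iter n T x) * u n.
apply/cvgr0Pnorm_lt => e e0; apply: contrapT => not_small.
have /choice[h hP] m : exists N, (m <= N)%N /\ e <= `|N%:R^-1 * A N|.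
  apply: contrapT => /forallNP noN; apply: not_small; exists m => // N /= mN.
  rewrite real_ltNge ?realE ?normr_ge0 ?(ltW e0)//.
  by apply/negP => eN; apply: (noN N).
(* Since h m >= m, the gap after [b k] exceeds k, so gaps tend to infinity, while every [b k] with k
   > 0 is a time with average at least [e]. *)
pose b := fix b k := if k is k.+1 then h (b k + k).+1 else 0%N.
have bS k : ((b k + k).+1 <= b k.+1)%N by have [] := hP (b k + k).+1.
have b_incr k : (b k < b k.+1)%N by apply: leq_trans (bS k); rewrite ltnS leq_addr.
have gap : (b k.+1 - b k)%N @[k --> \oo] --> \oo.
  apply/cvgnyPge => G; near=> k; apply: (@leq_trans k).
    by near: k; exact: nbhs_infty_ge.
  by rewrite leq_subRL ?(ltnW (b_incr k))// (leq_trans _ (bS k)).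
have := momo b erefl b_incr gap (fun k => iter (b k) T x) f cf.
move=> /cvgr0Pnorm_lt/(_ _ e0) small_K.
have [K [K0 smallK]] : exists K, (0 < K)%N /\ _ :=
  filter_ex (filterI (nbhs_infty_gt 0) small_K).
move: smallK; rewrite real_ltNge ?realE ?normr_ge0 ?(ltW e0)// => /negP; apply.
case: K K0 => // K _; have [_ /le_trans] := hP (b K + K).+1; apply.
rewrite !normrM ler_wpM2l//= -/(b K.+1) [leRHS]ger0_norm ?sumr_ge0//.
(* Cutting the orbit of [x] at the times [b k], the triangle inequality bounds the full sum by the
   sum of the moduli of the block sums. *)
rewrite /A (big_blocks (erefl : b 0%N = 0%N) b_incr) (le_trans (ler_norm_sum _ _ _))//.
apply: ler_sum => k _; rewrite le_eqVlt; apply/orP; left; apply/eqP; congr `|_|.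
by apply: eq_big_nat => n /andP[kn _]; rewrite -iterD subnK.
Unshelve. all: by end_near. Qed.

Theorem corollary9 (R : realType) :
  (forall u : nat -> R[i],
     (forall (X : metricType R) (T : X -> X), dynamical_system T ->
        topological_entropy T = 0%E -> sarnak_property T u) <->
     (forall (X : metricType R) (T : X -> X), dynamical_system T ->
        topological_entropy T = 0%E -> strong_MOMO_property T u)) /\
  (sarnak_conjecture R <->
   (forall (X : metricType R) (T : X -> X), dynamical_system T ->
      topological_entropy T = 0%E ->
      strong_MOMO_property T (complex_mobius R))).
Proof.
have equiv (u : nat -> R[i]) :
    (forall (X : metricType R) (T : X -> X), dynamical_system T ->
       topological_entropy T = 0%E -> sarnak_property T u) <->
    (forall (X : metricType R) (T : X -> X), dynamical_system T ->
       topological_entropy T = 0%E -> strong_MOMO_property T u).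
  split; first exact: strong_MOMO_of_sarnak.
  by move=> momo X T dT T0; apply: sarnak_of_strong_MOMO; exact: momo.
by split; [exact: equiv|exact: (equiv (complex_mobius R))].
Qed.
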